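(* Let $0<\alpha<1$. Then there is a constant $c>0$ such that for every $f\in\Lambda_\alpha$ and for arbitrary unitary operators $U$ and $V$ on Hilbert space the following inequality holds: $$\|f(U)-f(V)\|\le c\,\|f\|_{\Lambda_\alpha}\,\|U-V\|^\alpha .$$
   Context: Let $\mathbb T$ be the unit circle. For $0<\alpha<1$, $\Lambda_\alpha$ is the Hölder class of functions $f$ on $\mathbb T$ with $|f(\zeta)-f(\tau)|\le\mathrm{const}\,|\zeta-\tau|^\alpha$, $\zeta,\tau\in\mathbb T$, with seminorm $\|f\|_{\Lambda_\alpha}=\sup_{\zeta\ne\tau}|f(\zeta)-f(\tau)|/|\zeta-\tau|^\alpha$. *)

(* Defs.v *)
From HB Require Import structures.
From mathcomp Require Import all_boot all_order all_algebra.
From mathcomp Require Import all_classical all_reals all_analysis.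
From mathcomp Require Import complex.

Set Implicit Arguments.
Unset Strict Implicit.
Unset Printing Implicit Defensive.

Import Order.TTheory GRing.Theory Num.Theory.
Import numFieldNormedType.Exports.

Local Open Scope classical_set_scope.
Local Open Scope ring_scope.
Local Open Scope complex_scope.

(* The inner product is linear in its first argument and conjugate-linear in
   the second one. *)
HB.mixin Record CompleteNormedModule_isHilbert (R : realType) H
    of CompleteNormedModule R[i] H := {
  hdot : {dot H for (@Num.conj R[i])} ;
  sqr_normE : forall x : H, `|x| ^+ 2 = hdot x x
}.

#[short(type="hilbertType")]
HB.structure Definition Hilbert (R : realType) :=
  {H of CompleteNormedModule_isHilbert R H & CompleteNormedModule R[i] H}.

(* In a normed space over R[i] the library norm is R[i]-valued (with values
   that are nonnegative reals); this is the same norm with values in R. *)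
Definition rnorm (R : realType) (V : normedZmodType R[i]) (x : V) : R :=
  complex.Re `|x|.

Section operators.
Context (R : realType) (H : hilbertType R).

Definition bounded_operator (A : H -> H) : Prop := linear A /\ continuous A.

(* As a real-valued supremum, this is meaningful for bounded operators. *)
Definition opnorm (A : H -> H) : R :=
  sup [set rnorm (A x) | x in [set x : H | rnorm x <= 1]].

(* The adjoint is part of the data, but it is determined by the operator. *)
Record unitary := Unitary {
  unitary_op :> {linear H -> H} ;
  adjoint : {linear H -> H} ;
  adjointP : forall x y, hdot (unitary_op x) y = hdot x (adjoint y) ;
  adjointK : cancel unitary_op adjoint ;
  unitaryK : cancel adjoint unitary_op
}.

Definition unitary_pow (U : unitary) (k : int) : H -> H :=
  match k with
  | Posz n => iter n U
  | Negz n => iter n.+1 (adjoint U)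
  end.

End operators.

Section circle.
Context (R : realType).

Definition unit_circle : set R[i] := [set z | `|z| = 1].

(* Functions on the circle are represented by functions on R[i], of which only
   the values on unit_circle are used. *)
Definition holder (a : R) (f : R[i] -> R[i]) : Prop :=
  exists K : R, forall z w, unit_circle z -> unit_circle w ->
    rnorm (f z - f w) <= K * rnorm (z - w) `^ a.

Definition holder_seminorm (a : R) (f : R[i] -> R[i]) : R :=
  sup [set r | exists z w, [/\ unit_circle z, unit_circle w, z != w
                            & r = rnorm (f z - f w) / rnorm (z - w) `^ a]].

(* sum_(-n <= k <= n) (c k) z^k *)
Definition trig_poly (n : nat) (c : int -> R[i]) (z : R[i]) : R[i] :=
  \sum_(j < n.*2.+1) c (j%:Z - n%:Z) * z ^ (j%:Z - n%:Z).

Definition trig_poly_op (H : hilbertType R) (n : nat) (c : int -> R[i])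
    (U : unitary H) (x : H) : H :=
  \sum_(j < n.*2.+1) c (j%:Z - n%:Z) *: unitary_pow U (j%:Z - n%:Z) x.

(* A = f(U) for f continuous on the circle: the functional calculus is the
   extension by continuity, from the uniform norm on the circle to the operator
   norm, of p |-> p(U) on trigonometric polynomials.  As the norm of p(U) is at
   most the maximum of |p| on the circle, A exists, is unique and does not
   depend on the approximating sequence. *)
Definition is_fcalc (H : hilbertType R) (f : R[i] -> R[i]) (U : unitary H)
    (A : H -> H) : Prop :=
  bounded_operator A /\
  exists (n : nat -> nat) (c : nat -> int -> R[i]),
    (forall e : R, 0 < e -> \forall k \near \oo, forall z, unit_circle z ->
       rnorm (trig_poly (n k) (c k) z - f z) <= e) /\
    opnorm (trig_poly_op (n k) (c k) U \- A) @[k --> \oo] --> (0 : R).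

(* The default value 0 is reached only when f is not continuous on the
   circle. *)
Definition fcalc (H : hilbertType R) (f : R[i] -> R[i]) (U : unitary H) :
    H -> H :=
  xget (fun=> 0) (is_fcalc f U).

End circle.

(* Main.v *)
(** Bernstein's inequality for unitary operators: for a polynomial p of degree
    at most N, [|p(U) - p(V)| <= N * max |p| * |U - V|].  It comes from
    [p(U) - p(V) = sum_(j, k < N) p_(j+k+1) U^j (U - V) V^k], the Cauchy-Schwarz
    inequality in k, and the bound [N * (max |p|)^2] on the squares of the tails
    [sum_j p_(j+k+1) u^j], summed over k, on the circle; the passage from the
    circle to the operator is von Neumann's inequality, proved here for families
    of polynomials by Parseval's identity over roots of unity.

    Approximating f by its Jackson means p_m of degree about 2^m, with error
    O(2^(-a m)), and applying Bernstein's inequality to p_(k+1) - p_k gives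
    [|p_m(U) - p_m(V)| = O(2^((1-a) m) |U - V|)], because [a < 1].  Choosing 2^m
    of the order of [1 / |U - V|] balances this with the approximation error. *)

From HB Require Import structures.
Require Import Defs.
From mathcomp Require Import all_boot all_order all_algebra.
From mathcomp Require Import all_classical all_reals all_analysis.
From mathcomp Require Import complex.
From mathcomp Require cyclic cyclotomic separable.
From mathcomp Require Import ring lra zify.

Set Implicit Arguments.
Unset Strict Implicit.
Unset Printing Implicit Defensive.

Import Order.TTheory GRing.Theory Num.Theory.
Import numFieldNormedType.Exports.
Local Open Scope classical_set_scope.
Local Open Scope ring_scope.
Local Open Scope complex_scope.

(** * Real-valued norm, unit circle, roots of unity *)

Section complex_norm.
Context {R : realType}.
Implicit Types V : normedZmodType R[i].

Lemma normE V (x : V) : `|x| = (rnorm x)%:C.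
Proof. by rewrite /rnorm RRe_real// normr_real. Qed.

Lemma rnorm_ge0 V (x : V) : 0 <= rnorm x.
Proof. by rewrite -ler0c -normE. Qed.

Lemma rnorm0 V : rnorm (0 : V) = 0.
Proof. by rewrite /rnorm normr0. Qed.

Lemma rnorm_eq0 V (x : V) : (rnorm x == 0) = (x == 0).
Proof. by rewrite -[x == 0]normr_eq0 normE -[0 in RHS]/(0%:C) (inj_eq (@complexI _)). Qed.

Lemma ler_rnormD V (x y : V) : rnorm (x + y) <= rnorm x + rnorm y.
Proof. by rewrite -lecR rmorphD/= -!normE ler_normD. Qed.

Lemma rnormN V (x : V) : rnorm (- x) = rnorm x.
Proof. by rewrite /rnorm normrN. Qed.

Lemma rdistrC V (x y : V) : rnorm (x - y) = rnorm (y - x).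
Proof. by rewrite /rnorm distrC. Qed.

Lemma ler_rdistD V (z x y : V) : rnorm (x - y) <= rnorm (x - z) + rnorm (z - y).
Proof. by rewrite -lecR rmorphD/= -!normE ler_distD. Qed.

Lemma ler_rnorm_sum V I (r : seq I) (P : pred I) (F : I -> V) :
  rnorm (\sum_(i <- r | P i) F i) <= \sum_(i <- r | P i) rnorm (F i).
Proof.
rewrite -lecR rmorph_sum/= -normE (le_trans (ler_norm_sum _ _ _))//.
by apply: ler_sum => i _; rewrite normE.
Qed.

Lemma rnormZ (V : normedModType R[i]) (a : R[i]) (x : V) :
  rnorm (a *: x) = rnorm a * rnorm x.
Proof. by apply: complexI; rewrite rmorphM/= -!normE normrZ. Qed.

Lemma rnormM (a b : R[i]) : rnorm (a * b) = rnorm a * rnorm b.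
Proof. by apply: complexI; rewrite rmorphM/= -!normE normrM. Qed.

Lemma rnormX (a : R[i]) n : rnorm (a ^+ n) = rnorm a ^+ n.
Proof. by apply: complexI; rewrite rmorphXn/= -!normE normrX. Qed.

Lemma rnorm_conj (a : R[i]) : rnorm (Num.conj a) = rnorm a.
Proof. by rewrite /rnorm norm_conjC. Qed.

Lemma rnormV (a : R[i]) : rnorm a^-1 = (rnorm a)^-1.
Proof. by apply: complexI; rewrite fmorphV/= -!normE normfV. Qed.

Lemma rnorm_real (r : R) : rnorm (r%:C) = `|r|.
Proof. by rewrite /rnorm normc_def/= expr0n addr0 sqrtr_sqr. Qed.

Lemma unit_circleE (z : R[i]) : unit_circle z <-> rnorm z = 1.
Proof.
rewrite /unit_circle/= normE; split => [h|->//].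
exact: complexI.
Qed.

Lemma unit_circleM (z w : R[i]) :
  unit_circle z -> unit_circle w -> unit_circle (z * w).
Proof. by rewrite /unit_circle/= normrM => -> ->; rewrite mulr1. Qed.

Lemma unit_circleX (z : R[i]) n : unit_circle z -> unit_circle (z ^+ n).
Proof. by rewrite /unit_circle/= normrX => ->; rewrite expr1n. Qed.

Lemma unit_circleV (z : R[i]) : unit_circle z -> unit_circle z^-1.
Proof. by rewrite /unit_circle/= normfV => ->; rewrite invr1. Qed.

Lemma unit_circle1 : unit_circle (1 : R[i]).
Proof. by rewrite /unit_circle/= normr1. Qed.

Lemma unit_circleN (z : R[i]) : unit_circle z -> unit_circle (- z).
Proof. by rewrite /unit_circle/= normrN. Qed.

Lemma unit_circle_neq0 (z : R[i]) : unit_circle z -> z != 0.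
Proof. by rewrite /unit_circle/= -normr_eq0 => ->; rewrite oner_eq0. Qed.

Lemma unit_circle_conj (z : R[i]) : unit_circle z -> Num.conj z = z^-1.
Proof. by move=> z1; rewrite invC_norm z1 expr1n invr1 mul1r. Qed.

Lemma unit_circle_root n (z : R[i]) : (0 < n)%N ->
  unit_circle (z ^+ n) -> unit_circle z.
Proof.
by move=> n0; rewrite /unit_circle/= normrX => /eqP; rewrite pexpr_eq1// => /eqP.
Qed.

Lemma prim_root_unit_circle n (w : R[i]) : n.-primitive_root w -> unit_circle w.
Proof.
move=> pw; apply: (unit_circle_root (prim_order_gt0 pw)).
by rewrite (prim_expr_order pw); exact: unit_circle1.
Qed.

(** [X^n - 1] splits over [R[i]] and is separable in characteristic 0, so it has n distinct roots; n
    distinct n-th roots of unity in a field include a primitive one. *)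
Lemma prim_root_ex n : (0 < n)%N -> exists w : R[i], n.-primitive_root w.
Proof.
move=> n_gt0; pose p : {poly R[i]} := 'X^n - 1.
have [r Dp] := closed_field_poly_normal p.
have sz_p : size p = n.+1 by rewrite /p size_XnsubC.
have mon_p : lead_coef p = 1 by exact: (monicP (monicXnsubC 1 n_gt0)).
rewrite mon_p scale1r in Dp.
have sz_r : size r = n.
  by apply: succn_inj; rewrite -sz_p Dp size_prod_XsubC.
have : has n.-primitive_root r.
  apply: cyclic.has_prim_root => //; last by rewrite sz_r.
  - apply/allP => z zr; rewrite unity_rootE -subr_eq0.
    have -> : z ^+ n - 1 = p.[z] by rewrite /p !hornerE.
    by rewrite Dp -rootE root_prod_XsubC.
  - rewrite -separable.separable_prod_XsubC -Dp.
    by apply: cyclotomic.separable_Xn_sub_1; rewrite pnatr_eq0 -lt0n.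
by case/hasP => w _ ?; exists w.
Qed.

End complex_norm.

(** * Parseval's identity over roots of unity *)

Section parseval.
Context {R : realType}.
Local Notation C := R[i].

(** Orthogonality of characters: the summands are the powers of [y = w^m / w^l], and since [y^n = 1]
    the geometric sum vanishes unless [y = 1], that is, unless [m = l]. *)
Lemma prim_root_sum n (w : C) (m l : nat) : n.-primitive_root w ->
  (m < n)%N -> (l < n)%N ->
  \sum_(i < n) w ^+ (i * m) * Num.conj (w ^+ (i * l)) = (n * (m == l))%:R.
Proof.
move=> pw mn ln; have w1 := prim_root_unit_circle pw.
have w0 := unit_circle_neq0 w1.
pose y := w ^+ m / w ^+ l.
have wl0 : w ^+ l != 0 by rewrite expf_neq0.
rewrite (eq_bigr (fun i : 'I_n => y ^+ i)) => [|i _]; last first.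
  rewrite rmorphXn/= unit_circle_conj// exprVn /y expr_div_n.
  by rewrite !exprM ![_ ^+ i ^+ _]exprAC.
have [ml|ml] := eqVneq m l.
  rewrite /y ml divff// (eq_bigr (fun=> 1)) => [|i _]; last by rewrite expr1n.
  by rewrite sumr_const card_ord muln1.
have y1 : y - 1 != 0.
  rewrite subr_eq0 -[1](divff wl0) (inj_eq (mulIf _)) ?invr_eq0//.
  by rewrite (eq_prim_root_expr pw) !modn_small.
apply: (mulfI y1); rewrite -subrX1 muln0 mulr0.
rewrite /y expr_div_n -!exprM ![(_ * n)%N]mulnC !exprM (prim_expr_order pw).
by rewrite !expr1n divr1 subrr.
Qed.

(** Expanding both slots of the form leaves only the diagonal terms by orthogonality; [n <= M] keeps
    distinct exponents distinct modulo M. The form is arbitrary so as to cover both scalars and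
    vectors of a Hilbert space, and the rotation [z] allows sampling on any coset of the roots of
    unity. *)
Lemma parseval (V : lmodType C) (form : {dot V for (@Num.conj C)}) M n
    (w z : C) (v : nat -> V) : M.-primitive_root w -> unit_circle z -> (n <= M)%N ->
  let F i := \sum_(m < n) (z * w ^+ i) ^+ m *: v m in
  \sum_(i < M) form (F i) (F i) = M%:R * \sum_(m < n) form (v m) (v m).
Proof.
move=> pw z1 nM F.
have E (i : 'I_M) : form (F i) (F i) = \sum_(m < n) \sum_(l < n)
    (form (z ^+ m *: v m) (z ^+ l *: v l) *
     (w ^+ (i * m) * Num.conj (w ^+ (i * l)))).
  rewrite {1}/F linear_sumlz; apply: eq_bigr => m _.
  rewrite /F linear_sumr; apply: eq_bigr => l _.
  rewrite !exprMn -!exprM ![z ^+ _ * _]mulrC -!scalerA.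
  rewrite [LHS]linearZl_LR linearZr_LR/=; ring.
rewrite (eq_bigr _ (fun i _ => E i)) exchange_big/= mulr_sumr.
apply: eq_bigr => m _; rewrite exchange_big/= (bigD1 m)//=.
rewrite [X in _ + X]big1 ?addr0 => [|l lm].
  rewrite -mulr_sumr (prim_root_sum pw) ?(leq_trans _ nM)// eqxx muln1.
  by rewrite dnormZ normrX z1 !expr1n mul1r mulrC.
rewrite -mulr_sumr (prim_root_sum pw) ?(leq_trans _ nM)//.
by rewrite [_ == _](inj_eq val_inj) eq_sym (negPf lm) muln0 mulr0.
Qed.

(** The standard inner product of the complex line, made an instance of a dot product so that
    [parseval] applies to scalar polynomials. *)
Definition cdot (x y : C^o) : C := x * Num.conj y.

Fact cdot_bilinear : bilinear_for *%R (Num.conj \; *%R) cdot.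
Proof.
split=> [y a x x'|x a y y']; rewrite /cdot/= ?rmorphD/= ?rmorphM/=.
  by rewrite mulrDl mulrA.
by rewrite mulrDr mulrCA.
Qed.

HB.instance Definition _ :=
  bilinear_isBilinear.Build C C^o C^o C *%R (Num.conj \; *%R) cdot cdot_bilinear.

Fact cdot_hermitian (x y : C^o) : cdot x y = (-1) ^+ false * Num.conj (cdot y x).
Proof. by rewrite /cdot expr0 mul1r rmorphM/= conjCK mulrC. Qed.

HB.instance Definition _ :=
  isHermitianSesquilinear.Build C C^o false (@Num.conj C) cdot cdot_hermitian.

Fact cdot_gt0 (x : C^o) : x != 0 -> 0 < cdot x x.
Proof. by move=> x0; rewrite /cdot -normCK exprn_gt0// normr_gt0. Qed.

HB.instance Definition _ := isDotProduct.Build C C^o cdot cdot_gt0.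

Lemma parseval_scalar M n (w z : C) (a : nat -> C) :
  M.-primitive_root w -> unit_circle z -> (n <= M)%N ->
  \sum_(i < M) rnorm (\sum_(m < n) a m * (z * w ^+ i) ^+ m) ^+ 2
  = M%:R * \sum_(m < n) rnorm (a m) ^+ 2.
Proof.
move=> pw z1 nM; have := @parseval _ cdot _ _ _ _ a pw z1 nM.
have cE (x : C) : cdot x x = (rnorm x ^+ 2)%:C.
  by rewrite /cdot -normCK normE rmorphXn.
rewrite /= (eq_bigr _ (fun (i : 'I_M) _ => cE _)) (eq_bigr _ (fun (i : 'I_n) _ => cE _)).
rewrite -!rmorph_sum/= -(rmorph_nat (real_complex R)) -rmorphM => /complexI <-.
by apply: eq_bigr => i _; under eq_bigr do rewrite mulrC.
Qed.

Lemma parseval_hilbert (H : hilbertType R) M n (w : C) (v : nat -> H) :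
  M.-primitive_root w -> (n <= M)%N ->
  \sum_(i < M) rnorm (\sum_(m < n) (w ^+ i) ^+ m *: v m) ^+ 2
  = M%:R * \sum_(m < n) rnorm (v m) ^+ 2.
Proof.
move=> pw nM; have := @parseval _ hdot _ _ _ _ v pw unit_circle1 nM.
have cE (x : H) : hdot x x = (rnorm x ^+ 2)%:C.
  by rewrite -sqr_normE normE rmorphXn.
rewrite /= (eq_bigr _ (fun (i : 'I_M) _ => cE _)) (eq_bigr _ (fun (i : 'I_n) _ => cE _)).
rewrite -!rmorph_sum/= -(rmorph_nat (real_complex R)) -rmorphM => /complexI <-.
apply: eq_bigr => i _; congr (rnorm _ ^+ 2).
by apply: eq_bigr => m _; rewrite mul1r.
Qed.

End parseval.

(** * Algebra of polynomials in an operator *)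

Section iterated_operators.
Context {K : comNzRingType} {V : lmodType K}.
Implicit Types (f g : {linear V -> V}) (x y : V).

Lemma iter_sum f n I (r : seq I) (P : pred I) (F : I -> V) :
  iter n f (\sum_(i <- r | P i) F i) = \sum_(i <- r | P i) iter n f (F i).
Proof. by elim: n => //= n ->; rewrite linear_sum. Qed.

Lemma iterZ f n a x : iter n f (a *: x) = a *: iter n f x.
Proof. by elim: n => //= n ->; rewrite linearZ. Qed.

Lemma iterB f n x y : iter n f (x - y) = iter n f x - iter n f y.
Proof. by elim: n => //= n ->; rewrite linearB. Qed.

(** Noncommutative divided difference, by telescoping: powers of [f] stay on the left and powers of
    [g] on the right, so the two maps need not commute. *)
Lemma horner_iter_sub f g N (p : nat -> K) x :
  (forall m, (N < m)%N -> p m = 0) ->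
  \sum_(m < N.+1) p m *: iter m f x - \sum_(m < N.+1) p m *: iter m g x =
  \sum_(k < N) \sum_(j < N) p (j + k).+1 *:
    iter j f (f (iter k g x) - g (iter k g x)).
Proof.
(* [S k] is p with its first k coefficients removed and shifted down, evaluated at [f]. Splitting
   off its constant term gives [step]; [p0] kills the top term of [S k.+1], so both sums have the
   same range. *)
move=> p0; pose S k y := \sum_(j < N.+1) p (j + k)%N *: iter j f y.
have step (k : 'I_N) : \sum_(j < N) p (j + k).+1 *:
    iter j f (f (iter k g x) - g (iter k g x)) =
    (S k (iter k g x) - S k.+1 (iter k.+1 g x)) - p k *: iter k g x.
  set y := iter k g x; rewrite {1}/S big_ord_recl/= add0n.
  rewrite {1}/S big_ord_recr/= (p0 (N + k.+1)%N) ?scale0r ?addr0; last first.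
    by rewrite addnS ltnS leq_addr.
  rewrite [RHS]addrAC [p k *: y + _]addrC addrK.
  rewrite -sumrB; apply: eq_bigr => j _; rewrite iterB scalerBr.
  by rewrite -iterSr addnS /bump leq0n add1n addSn.
rewrite (eq_bigr _ (fun k _ => step k)) sumrB.
have -> : \sum_(k < N) (S k (iter k g x) - S k.+1 (iter k.+1 g x)) =
    S 0%N x - S N (iter N g x).
  rewrite -(big_mkord xpredT (fun k => S k (iter k g x) - S k.+1 (iter k.+1 g x))).
  rewrite -[LHS]opprK -sumrN.
  under eq_bigr do rewrite opprB.
  by rewrite (telescope_sumr (fun k => S k (iter k g x)))// opprB.
have -> y : S N y = p N *: y.
  rewrite /S big_ord_recl/= big1 ?addr0// => j _.
  by rewrite p0 ?scale0r// /bump leq0n add1n addSn ltnS leq_addl.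
rewrite [X in _ - X = _]big_ord_recr/= opprD addrA [LHS]addrAC.
congr (_ - _ - _).
by apply: eq_bigr => j _; rewrite addn0.
Qed.

(** The Cauchy product of a scalar polynomial and a polynomial with vector coefficients, sorted by
    total degree so that Parseval applies to the product. *)
Lemma horner_scale_conv n N (a : nat -> K) (v : nat -> V) (u : K) :
  (\sum_(j < n) a j * u ^+ j) *: (\sum_(m < N) u ^+ m *: v m) =
  \sum_(p < n + N) u ^+ p *:
    (\sum_(j < n) \sum_(m < N | (j + m == p)%N) a j *: v m).
Proof.
under [RHS]eq_bigr do rewrite scaler_sumr.
rewrite exchange_big/= scaler_suml; apply: eq_bigr => j _.
under [RHS]eq_bigr do rewrite big_mkcond scaler_sumr.
rewrite exchange_big/= scaler_sumr; apply: eq_bigr => m _.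
have jm : (j + m < n + N)%N by rewrite -addSn leq_add// ltnW.
rewrite (bigD1 (Ordinal jm))//= eqxx [X in _ + X]big1 ?addr0 => [|p pjm].
  by rewrite !scalerA -mulrA -exprD mulrC.
rewrite -[X in X == _]/(val (Ordinal jm)) (inj_eq val_inj) eq_sym.
by rewrite (negPf pjm) scaler0.
Qed.

End iterated_operators.

(** * Von Neumann's inequality for families of polynomials *)

Section transference.
Context {R : realType} {H : hilbertType R}.
Local Notation C := R[i].

Lemma iter_isometry (W : H -> H) n x :
  (forall y, rnorm (W y) = rnorm y) -> rnorm (iter n W x) = rnorm x.
Proof. by move=> Wi; elim: n => //= n IH; rewrite Wi. Qed.

(** Dividing by L and letting L grow removes the bounded error [c]. This is how the boundary terms
    disappear in the transference argument. *)
Lemma affine_le (a b c : R) : (forall L : nat, L%:R * a <= L%:R * b + c) -> a <= b.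
Proof.
move=> h; rewrite leNgt; apply/negP => ba.
have ab0 : 0 < a - b by rewrite subr_gt0.
have c0 : 0 <= c by have := h 0%N; rewrite !mul0r add0r.
have := h (Num.bound (c / (a - b))).
have := archi_boundP (divr_ge0 c0 (ltW ab0)).
by rewrite ltr_pdivrMr//; set L := _%:R; lra.
Qed.

(* Against g(z) = sum_(m < N) z^m W^(N-1-m) x, multiplication by
   p(z) = sum_j c_j z^j produces the coefficients W^t (p(W) x), up to the first
   and last n of them; Parseval then compares p(W) with the values of p at the
   roots of unity, and N goes to infinity. *)
Lemma transference (W : {linear H -> H}) K n (c : nat -> nat -> C) (B : R) x :
  (forall y, rnorm (W y) = rnorm y) ->
  (forall z, unit_circle z ->
     \sum_(k < K) rnorm (\sum_(j < n) c k j * z ^+ j) ^+ 2 <= B) ->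
  \sum_(k < K) rnorm (\sum_(j < n) c k j *: iter j W x) ^+ 2 <= B * rnorm x ^+ 2.
Proof.
move=> Wi hB; set S := (X in X <= _).
(* The lower bound counts L copies of the sum, the upper bound [N = L + n] copies of
   [B * rnorm x ^+ 2]; the excess n does not depend on L. *)
apply: (@affine_le _ _ (n%:R * (B * rnorm x ^+ 2))) => L.
rewrite -mulrDl -natrD; pose N := (L + n)%N; rewrite -/N.
have [nN0|n0] := posnP (n + N).
  have [N0 L0] : N = 0%N /\ L = 0%N by move: nN0; rewrite /N; lia.
  by rewrite N0 L0 !mul0r.
have [w pw] := prim_root_ex (R := R) n0.
have w1 := prim_root_unit_circle pw.
pose g i := \sum_(m < N) (w ^+ i) ^+ m *: iter (N - m.+1) W x.
pose v k p := \sum_(j < n) \sum_(m < N | (j + m == p)%N)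
  c k j *: iter (N - m.+1) W x.
have gE : \sum_(i < n + N) rnorm (g i) ^+ 2 = (n + N)%:R * (N%:R * rnorm x ^+ 2).
  rewrite (parseval_hilbert (fun m => iter (N - m.+1) W x) pw) ?leq_addl//.
  congr (_ * _); under eq_bigr do rewrite iter_isometry//.
  by rewrite sumr_const card_ord mulr_natl.
have vE k : \sum_(i < n + N) rnorm (\sum_(j < n) c k j * (w ^+ i) ^+ j) ^+ 2 *
     rnorm (g i) ^+ 2 = (n + N)%:R * \sum_(p < n + N) rnorm (v k p) ^+ 2.
  rewrite -(parseval_hilbert (v k) pw)//; apply: eq_bigr => i _.
  by rewrite -(horner_scale_conv n N (c k) (fun m => iter (N - m.+1) W x)) rnormZ exprMn.
(* For [p = n + s] with [s < L], the coefficient [v k p] is [W^(L-s-1)] applied to the polynomial in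
   [W] at [x], hence has the same norm; the first and last n coefficients are dropped. *)
have inner k : L%:R * rnorm (\sum_(j < n) c k j *: iter j W x) ^+ 2 <=
    \sum_(p < n + N) rnorm (v k p) ^+ 2.
  rewrite big_split_ord/= big_split_ord/= addrCA -[leLHS]addr0.
  rewrite lerD//; last by rewrite addr_ge0// sumr_ge0// => i _; rewrite sqr_ge0.
  rewrite (eq_bigr (fun=> rnorm (\sum_(j < n) c k j *: iter j W x) ^+ 2)).
    by rewrite sumr_const card_ord mulr_natl.
  move=> s _; congr (_ ^+ 2); rewrite -[RHS](@iter_isometry W (L - s.+1))//.
  rewrite iter_sum; congr (rnorm _); apply: eq_bigr => j _.
  have jN : (n + s - j < N)%N.
    by rewrite /N addnC (leq_ltn_trans (leq_subr _ _))// ltn_add2r.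
  have js : (j <= n + s)%N by rewrite (leq_trans (ltnW (ltn_ord j)))// leq_addr.
  rewrite (big_pred1 (Ordinal jN)) => [|m]; last first.
    by rewrite -[RHS]/(val m == (n + s - j)%N) -[in RHS](eqn_add2l j) subnKC.
  rewrite iterZ -iterD /=; congr (_ *: iter _ W x).
  by rewrite /N; have := ltn_ord s; have := ltn_ord j; lia.
have nN0 : 0 < (n + N)%:R :> R by rewrite ltr0n.
rewrite -(ler_pM2l nN0).
apply: (@le_trans _ _ (\sum_(k < K) (n + N)%:R * \sum_(p < n + N) rnorm (v k p) ^+ 2)).
  by rewrite -mulr_sumr ler_pM2l// /S mulr_sumr ler_sum.
rewrite -(eq_bigr _ (fun (k : 'I_K) _ => vE k)) exchange_big/=.
under eq_bigr do rewrite -mulr_suml.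
apply: (@le_trans _ _ (\sum_(i < n + N) B * rnorm (g i) ^+ 2)).
  apply: ler_sum => i _; rewrite ler_wpM2r ?sqr_ge0// hB//.
  exact: unit_circleX.
rewrite -mulr_sumr gE le_eqVlt; apply/orP; left; apply/eqP; ring.
Qed.

End transference.

(** * Square sums of the tails of a polynomial on the circle *)

Section bernstein.
Context {R : realType}.
Local Notation C := R[i].

(** The scalar case of [horner_iter_sub], with multiplication by [u] and by [z] as the two
    operators. *)
Lemma horner_sub_tails N (p : nat -> C) (u z : C) :
  (forall m, (N < m)%N -> p m = 0) ->
  \sum_(m < N.+1) p m * u ^+ m - \sum_(m < N.+1) p m * z ^+ m =
  (u - z) * \sum_(k < N) (\sum_(j < N) p (j + k).+1 * u ^+ j) * z ^+ k.
Proof.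
move=> p0; pose mul (a : C) : {linear C^o -> C^o} := *:%R a.
have it a m (y : C^o) : iter m (mul a) y = a ^+ m * y.
  by elim: m => [|m IH]; rewrite ?mul1r// iterS IH exprS -mulrA.
have := @horner_iter_sub C C^o (mul u) (mul z) N p 1 p0.
under eq_bigr do rewrite it mulr1.
under [X in _ - X]eq_bigr do rewrite it mulr1.
move=> ->; rewrite mulr_sumr; apply: eq_bigr => k _.
rewrite mulr_suml mulr_sumr; apply: eq_bigr => j _.
by rewrite !it /mul/= /GRing.scale/=; ring.
Qed.

(* The tails are the coefficients of the divided difference (p u - p z)/(u - z)
   as a polynomial in z; it is sampled at the N points with z^N = - u^N, where
   1/(u - z) is half a geometric sum, of mean square N/4. *)
Lemma sum_tails_le N (p : nat -> C) (B : R) (u : C) : (0 < N)%N ->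
  (forall m, (N < m)%N -> p m = 0) ->
  (forall z, unit_circle z -> rnorm (\sum_(m < N.+1) p m * z ^+ m) <= B) ->
  unit_circle u ->
  \sum_(k < N) rnorm (\sum_(j < N) p (j + k).+1 * u ^+ j) ^+ 2 <= N%:R * B ^+ 2.
Proof.
move=> N0 p0 hB u1; have [w pw] := prim_root_ex (R := R) N0.
have w1 := prim_root_unit_circle pw.
(* The points [u * eta * w ^+ i] are the N solutions of [z^N = - u^N]; none of them equals [u], so
   dividing by [u - z] is harmless. *)
pose eta : C := N.-root (-1); have etaN : eta ^+ N = -1 by rewrite rootCK.
have eta1 : unit_circle eta.
  by apply: (unit_circle_root N0); rewrite etaN; apply/unit_circleN/unit_circle1.
have ue1 : unit_circle (u * eta) by exact: unit_circleM.
pose a k := \sum_(j < N) p (j + k).+1 * u ^+ j.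
have N0' : 0 < N%:R :> R by rewrite ltr0n.
rewrite -(ler_pM2l N0') -(parseval_scalar a pw ue1)//.
have DE := parseval_scalar (fun j => u ^+ (N.-1 - j)) pw ue1 (leqnn N).
have -> : N%:R * (N%:R * B ^+ 2) = B ^+ 2 *
    \sum_(i < N) rnorm (\sum_(m < N) u ^+ (N.-1 - m) * (u * eta * w ^+ i) ^+ m) ^+ 2.
  rewrite DE; under eq_bigr do rewrite rnormX (unit_circleE _).1// expr1n expr1n.
  by rewrite sumr_const card_ord; ring.
rewrite mulr_sumr; apply: ler_sum => i _; rewrite -exprMn.
set z := u * eta * w ^+ i.
have z1 : unit_circle z by apply: unit_circleM => //; exact: unit_circleX.
have zN : z ^+ N = - u ^+ N.
  by rewrite /z !exprMn etaN exprAC (prim_expr_order pw) expr1n mulr1 mulrN1.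
have B0 : 0 <= B by apply: le_trans (rnorm_ge0 _) (hB _ u1).
set q := \sum_(m < N) a m * _; set D := \sum_(m < N) _ * _.
(* Pointwise comparison at each sample: [(u - z) D = u^N - z^N = 2 u^N] has modulus 2, while
   [(u - z) q] is the difference of the values of p at [u] and [z], of modulus at most [2 B]. *)
suff : rnorm q <= B * rnorm D.
  by move=> h; rewrite ler_pXn2r// nnegrE ?mulr_ge0 ?rnorm_ge0.
have uD : rnorm (u - z) * rnorm D = 2.
  rewrite -rnormM -subrXX zN opprK -mulr2n -[X in rnorm X]mulr_natl rnormM rnormX.
  rewrite (unit_circleE u).1// expr1n mulr1 -(rmorph_nat (real_complex R)).
  by rewrite rnorm_real ger0_norm.
have qu : rnorm (u - z) * rnorm q <= B + B.
  rewrite -rnormM -horner_sub_tails// (le_trans (ler_rnormD _ _))//.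
  by rewrite rnormN lerD// hB.
rewrite -(ler_pM2r (_ : 0 < 2)) // -uD; set r := rnorm (u - z) in uD qu *.
have /ler_wpM2r/(_ _ _ qu) := rnorm_ge0 D.
have -> : r * rnorm q * rnorm D = rnorm q * (r * rnorm D) by ring.
by rewrite uD; lra.
Qed.

End bernstein.

(** * Bernstein's inequality for unitary operators *)

Section unitary_operators.
Context {R : realType} {H : hilbertType R}.
Local Notation C := R[i].
Implicit Types (U V : unitary H) (x y : H).

Lemma hdotxx x : hdot x x = (rnorm x ^+ 2)%:C.
Proof. by rewrite -sqr_normE normE rmorphXn. Qed.

Lemma hdot_conj x y : hdot x y = Num.conj (hdot y x).
Proof. by rewrite [LHS]hermC expr0 mul1r. Qed.

(** Cauchy-Schwarz, from the nonnegative square norm of the component of [x] orthogonal to [y]. *)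
Lemma rnorm_hdot_le x y : rnorm (hdot x y) <= rnorm x * rnorm y.
Proof.
have [->|y0] := eqVneq y 0; first by rewrite linear0r !rnorm0 mulr0.
set d := hdot x y; pose t := d / hdot y y.
have ny : 0 < rnorm y by rewrite lt_def rnorm_ge0 rnorm_eq0 y0.
have y2 : hdot y y != 0 by rewrite dnorm_eq0.
have cy : Num.conj (hdot y y) = hdot y y by rewrite -hdot_conj.
have := dnorm_ge0 hdot (x - t *: y).
rewrite dnormB dnormZ linearZr_LR/= -/d.
have -> : Num.conj t = Num.conj d / hdot y y by rewrite /t fmorph_div/= cy.
rewrite rmorphM/= fmorph_div/= conjCK cy normf_div.
have -> : `|hdot y y| = hdot y y by rewrite ger0_norm// dnorm_ge0.
have -> : hdot x x + (`|d| / hdot y y) ^+ 2 * hdot y y -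
  (Num.conj d / hdot y y * d + d / hdot y y * Num.conj d) =
  hdot x x - `|d| ^+ 2 / hdot y y by rewrite expr_div_n normCK; field.
rewrite subr_ge0 ler_pdivrMr; last by rewrite dnorm_gt0.
rewrite normE !hdotxx -rmorphXn -rmorphM lecR -exprMn => h.
by rewrite -(ler_pXn2r (n := 2))// nnegrE ?mulr_ge0 ?rnorm_ge0.
Qed.

Lemma unitary_isometry U x : rnorm (U x) = rnorm x.
Proof.
apply/eqP; rewrite -(eqrXn2 (n := 2))// ?rnorm_ge0//; apply/eqP/complexI.
by rewrite -!hdotxx adjointP adjointK.
Qed.

Lemma adjoint_isometry U x : rnorm (adjoint U x) = rnorm x.
Proof. by rewrite -(unitary_isometry U) unitaryK. Qed.

Lemma iter_adjointP U n x y : hdot (iter n U x) y = hdot x (iter n (adjoint U) y).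
Proof. by elim: n x y => //= n IH x y; rewrite adjointP IH -iterSr. Qed.

Lemma iter_adjointK U n x : iter n (adjoint U) (iter n U x) = x.
Proof. by elim: n x => // n IH x; rewrite iterSr [iter n.+1 U x]iterS adjointK. Qed.

(** Sum [2 b t <= b^2 + t^2] over the family and divide by [2 t]; the case [t = 0] is separate
    because of this division. *)
Lemma sum_le_of_sum_sqr N (b : nat -> R) (t : R) : 0 <= t ->
  \sum_(k < N) b k ^+ 2 <= N%:R * t ^+ 2 -> \sum_(k < N) b k <= N%:R * t.
Proof.
rewrite le_eqVlt => /predU1P[<-|t0] h.
  rewrite mulr0 big1// => k _; apply/eqP; rewrite -sqrf_eq0.
  move: h; rewrite expr0n mulr0 => h.
  have /eqP : \sum_(k < N) b k ^+ 2 = 0.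
    by apply/eqP; rewrite eq_le h sumr_ge0// => i _; rewrite sqr_ge0.
  by rewrite psumr_eq0 => [/allP/(_ k (mem_index_enum _))//|i _]; rewrite sqr_ge0.
have t2 : 0 < t *+ 2 by rewrite mulrn_wgt0.
rewrite -(ler_pM2r t2) mulr_suml.
apply: (@le_trans _ _ (\sum_(k < N) (b k ^+ 2 + t ^+ 2))).
  apply: ler_sum => k _; rewrite mulrnAr -subr_ge0.
  have -> : b k ^+ 2 + t ^+ 2 - (b k * t) *+ 2 = (b k - t) ^+ 2 by ring.
  exact: sqr_ge0.
rewrite big_split/= sumr_const card_ord -[t ^+ 2 *+ N]mulr_natl.
have -> : N%:R * t * (t *+ 2) = N%:R * t ^+ 2 + N%:R * t ^+ 2 by ring.
by rewrite lerD2r.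
Qed.

(** By duality: in [hdot w w] the powers of [U] move to the second slot as powers of its adjoint.
    This leaves vectors of norm at most [d * rnorm x] paired with the tails [b k w], whose square
    sum is controlled by [transference] for the adjoint together with [sum_tails_le]. *)
Lemma bernstein U V N (p : nat -> C) (B d : R) x : (0 < N)%N ->
  (forall m, (N < m)%N -> p m = 0) ->
  (forall z, unit_circle z -> rnorm (\sum_(m < N.+1) p m * z ^+ m) <= B) ->
  (forall y, rnorm (U y - V y) <= d * rnorm y) ->
  rnorm (\sum_(m < N.+1) p m *: iter m U x - \sum_(m < N.+1) p m *: iter m V x)
    <= N%:R * B * d * rnorm x.
Proof.
move=> N0 p0 hB hd; rewrite horner_iter_sub//.
set w := (X in rnorm X <= _).
pose b k y := \sum_(j < N) Num.conj (p (j + k).+1) *: iter j (adjoint U) y.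
have wE y : hdot w y =
    \sum_(k < N) hdot (U (iter k V x) - V (iter k V x)) (b k y).
  rewrite /w linear_sumlz; apply: eq_bigr => k _.
  rewrite linear_sumlz linear_sumr; apply: eq_bigr => j _.
  rewrite [LHS]linearZl_LR/= iter_adjointP.
  by rewrite linearZr_LR/= conjCK.
have B0 : 0 <= B by apply: le_trans (rnorm_ge0 _) (hB _ unit_circle1).
have sb : \sum_(k < N) rnorm (b k w) ^+ 2 <= N%:R * (B * rnorm w) ^+ 2.
  rewrite exprMn mulrA; apply: (@transference _ _ (adjoint U) N N
    (fun k j => Num.conj (p (j + k).+1)) _ w (adjoint_isometry U)) => z z1.
  (* Conjugating the whole sum restores the coefficients of p and replaces [z] by its conjugate
     [z^-1], again a point of the circle. *)
  rewrite (eq_bigr (fun k : 'I_N =>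
    rnorm (\sum_(j < N) p (j + k).+1 * z^-1 ^+ j) ^+ 2)).
    by apply: sum_tails_le => //; exact: unit_circleV.
  move=> k _; congr (_ ^+ 2).
  rewrite -[LHS]rnorm_conj rmorph_sum/=; congr rnorm.
  by apply: eq_bigr => j _; rewrite rmorphM/= conjCK rmorphXn/= unit_circle_conj.
have [->|w0] := eqVneq w 0.
  have d0 : 0 <= d * rnorm x by apply: le_trans (rnorm_ge0 _) (hd _).
  by rewrite rnorm0 -mulrA mulr_ge0// mulr_ge0.
have nw : 0 < rnorm w by rewrite lt_def rnorm_ge0 rnorm_eq0 w0.
rewrite -(ler_pM2r nw) -expr2.
have -> : rnorm w ^+ 2 = rnorm (hdot w w).
  by rewrite hdotxx rnorm_real ger0_norm// sqr_ge0.
rewrite wE (le_trans (ler_rnorm_sum _ _ _))//.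
apply: (@le_trans _ _ (\sum_(k < N) (d * rnorm x) * rnorm (b k w))).
  apply: ler_sum => k _; apply: (le_trans (rnorm_hdot_le _ _)).
  rewrite ler_wpM2r ?rnorm_ge0// (le_trans (hd _))//.
  by rewrite iter_isometry//; exact: unitary_isometry.
rewrite -mulr_sumr.
have -> : N%:R * B * d * rnorm x * rnorm w = d * rnorm x * (N%:R * (B * rnorm w)) by ring.
apply: ler_wpM2l; first by apply: le_trans (rnorm_ge0 _) (hd _).
apply: (sum_le_of_sum_sqr (b := fun k => rnorm (b k w))) => //.
by rewrite mulr_ge0// rnorm_ge0.
Qed.

End unitary_operators.

(** * Trigonometric polynomials of unitary operators *)

Section trigonometric_polynomials.
Context {R : realType}.
Local Notation C := R[i].

Lemma trig_polyE n (c : int -> C) z : unit_circle z ->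
  trig_poly n c z = z ^- n * \sum_(j < n.*2.+1) c (j%:Z - n%:Z) * z ^+ j.
Proof.
move=> /unit_circle_neq0 z0; rewrite mulr_sumr; apply: eq_bigr => j _.
by rewrite expfzDr// exprnN [z ^ j%:Z * _]mulrC mulrCA.
Qed.

Lemma rnorm_trig_poly n (c : int -> C) z : unit_circle z ->
  rnorm (trig_poly n c z) = rnorm (\sum_(j < n.*2.+1) c (j%:Z - n%:Z) * z ^+ j).
Proof.
move=> z1; rewrite trig_polyE// rnormM rnormV rnormX.
by rewrite ((unit_circleE z).1 z1) expr1n invr1 mul1r.
Qed.

Context {H : hilbertType R}.
Implicit Types (U V : unitary H) (x y : H).

Lemma unitary_powB U (j n : nat) x :
  unitary_pow U (j%:Z - n%:Z) x = iter n (adjoint U) (iter j U x).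
Proof.
case: (leqP n j) => nj.
  rewrite subzn//= -[in RHS](subnKC nj) iterD.
  by rewrite iter_adjointK.
have -> : j%:Z - n%:Z = Negz (n - j).-1 by lia.
rewrite [LHS]/= -[RHS]/(iter _ _ _) -[in RHS](subnK (ltnW nj)) iterD iter_adjointK.
have -> : (n - j)%N = (n - j).-1.+1 by lia.
by [].
Qed.

(** Operator form of factoring out [z^-n]: an ordinary polynomial in [U] followed by an isometry, so
    results on polynomials carry over. *)
Lemma trig_poly_opE n (c : int -> C) U x :
  trig_poly_op n c U x =
  iter n (adjoint U) (\sum_(j < n.*2.+1) c (j%:Z - n%:Z) *: iter j U x).
Proof.
rewrite iter_sum; apply: eq_bigr => j _.
by rewrite iterZ unitary_powB.
Qed.

(** Von Neumann's inequality: [transference] for a family with a single member. *)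
Lemma rnorm_trig_poly_op_le n (c : int -> C) (B : R) U x :
  (forall z, unit_circle z -> rnorm (trig_poly n c z) <= B) ->
  rnorm (trig_poly_op n c U x) <= B * rnorm x.
Proof.
move=> hB; have B0 : 0 <= B by apply: le_trans (rnorm_ge0 _) (hB _ unit_circle1).
rewrite trig_poly_opE iter_isometry; last exact: adjoint_isometry.
rewrite -(ler_pXn2r (n := 2))// ?nnegrE ?mulr_ge0 ?rnorm_ge0// exprMn.
have := @transference _ _ U 1 n.*2.+1 (fun _ j => c (j%:Z - n%:Z)) (B ^+ 2) x
  (unitary_isometry U).
rewrite big_ord1; apply => z z1; rewrite big_ord1 -rnorm_trig_poly//.
by rewrite ler_pXn2r// ?nnegrE ?rnorm_ge0// hB.
Qed.

(** The adjoints are as close as the operators, because their difference is [adjoint U] composed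
    with [V - U] and then [adjoint V]; the powers follow by telescoping. *)
Lemma iter_adjoint_sub_le U V (d : R) n x :
  (forall y, rnorm (U y - V y) <= d * rnorm y) ->
  rnorm (iter n (adjoint U) x - iter n (adjoint V) x) <= n%:R * d * rnorm x.
Proof.
move=> hd; elim: n => [|n IH]; first by rewrite subrr rnorm0 !mul0r.
rewrite !iterS; set y := iter n (adjoint V) x.
apply: (le_trans (ler_rdistD (adjoint U y) _ _)).
rewrite -linearB adjoint_isometry -natr1 !mulrDl mul1r lerD//.
have -> : adjoint U y - adjoint V y =
    adjoint U (V (adjoint V y) - U (adjoint V y)).
  by rewrite linearB unitaryK adjointK.
rewrite adjoint_isometry rdistrC (le_trans (hd _))//.
by rewrite adjoint_isometry /y iter_isometry//; exact: adjoint_isometry.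
Qed.

(** In the constant, [2 n + 1] comes from [bernstein] for the polynomial part and [n] from
    exchanging the n-th powers of the adjoints. *)
Lemma trig_poly_op_lipschitz n (c : int -> C) (B d : R) U V x :
  (forall z, unit_circle z -> rnorm (trig_poly n c z) <= B) ->
  (forall y, rnorm (U y - V y) <= d * rnorm y) ->
  rnorm (trig_poly_op n c U x - trig_poly_op n c V x)
    <= (3 * n + 1)%:R * B * d * rnorm x.
Proof.
move=> hB hd; rewrite !trig_poly_opE.
set P := fun W : unitary H => \sum_(j < n.*2.+1) c (j%:Z - n%:Z) *: iter j W x.
rewrite -!/(P _).
apply: (le_trans (ler_rdistD (iter n (adjoint U) (P V)) _ _)).
have -> : (3 * n + 1 = n.*2.+1 + n)%N by lia.
rewrite natrD !mulrDl lerD//.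
  rewrite -iterB iter_isometry; last exact: adjoint_isometry.
  (* A zero coefficient is appended so that the degree bound is [2 n + 1], which is positive even
     for [n = 0], as [bernstein] requires. *)
  pose p m := if (m < n.*2.+1)%N then c (m%:Z - n%:Z) else 0.
  have PE W : P W = \sum_(m < n.*2.+2) p m *: iter m W x.
    rewrite big_ord_recr/= {2}/p ltnn scale0r addr0; apply: eq_bigr => j _.
    by rewrite /p ltn_ord.
  rewrite !PE; apply: bernstein => // [m nm|z z1].
    by rewrite /p ltnNge (ltnW nm).
  rewrite big_ord_recr/= {2}/p ltnn mul0r addr0.
  have := hB _ z1; rewrite rnorm_trig_poly//.
  by under [X in _ -> rnorm X <= _]eq_bigr do rewrite /p ltn_ord.
apply: (le_trans (iter_adjoint_sub_le _ _ hd)).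
have -> : n%:R * B * d * rnorm x = n%:R * d * (B * rnorm x) by ring.
have [->|n0] := posnP n; first by rewrite !mul0r.
have [d0|d0] := leP 0 d.
  rewrite ler_wpM2l ?mulr_ge0//.
  have := rnorm_trig_poly_op_le V x hB; rewrite trig_poly_opE iter_isometry//.
  exact: adjoint_isometry.
(* A negative [d] is compatible with [hd] only if the space is trivial. *)
have H0 y : rnorm y = 0.
  apply/eqP; rewrite eq_le rnorm_ge0 andbT leNgt; apply/negP => y0.
  have := le_trans (rnorm_ge0 _) (hd y).
  by rewrite nmulr_rge0// leNgt y0.
by rewrite !H0 !mulr0.
Qed.

End trigonometric_polynomials.

(** * Jackson approximation of Hölder functions *)

Section jackson.
Context {R : realType}.
Local Notation C := R[i].

(** For [t <= s] the term 1 suffices, for [t > s] the square does, as [a <= 2]. It reduces Hölder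
    increments to the second moment of the kernel. *)
Lemma powR_le_quadratic (a s t : R) : 0 <= a <= 2 -> 0 < s -> 0 <= t ->
  t `^ a <= s `^ a * (1 + (t / s) ^+ 2).
Proof.
move=> /andP[a0 a2] s0 t0; have ts0 : 0 <= t / s by rewrite divr_ge0// ltW.
rewrite -{1}(divfK (lt0r_neq0 s0) t) mulrC powRM// ?(ltW s0)//.
rewrite ler_wpM2l ?powR_ge0//; have [x1|x1] := leP (t / s) 1.
  apply: (@le_trans _ _ 1); last by rewrite lerDl sqr_ge0.
  have /(_ _ _ _ _ x1) := @ge0_ler_powR R a a0; rewrite powR1; apply.
    by rewrite nnegrE.
  by rewrite nnegrE.
apply: (@le_trans _ _ ((t / s) ^+ 2)); last by rewrite lerDr.
by rewrite -powR_mulrn// ler_powR// ltW.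
Qed.

(** A one-sided Dirichlet kernel: on the circle its squared modulus is n times the Fejér kernel, and
    its fourth power in modulus is the Jackson kernel up to normalisation. *)
Definition dirichlet n (u : C) : C := \sum_(j < n) u ^+ j.

Lemma conj_dirichlet n u : unit_circle u ->
  Num.conj (dirichlet n.+1 u) = u ^- n * dirichlet n.+1 u.
Proof.
move=> u1; have u0 := unit_circle_neq0 u1.
rewrite /dirichlet rmorph_sum/= mulr_sumr (reindex_inj rev_ord_inj)/=.
apply: eq_bigr => j _; rewrite rmorphXn/= unit_circle_conj// exprVn subSS.
have jn : (j <= n)%N by rewrite -ltnS.
have -> : u ^- n = u ^- (n - j) * u ^- j by rewrite -invfM -exprD subnK.
by rewrite -mulrA mulVf ?mulr1// expf_neq0.
Qed.

(** Conjugation reverses the coefficients, so the Jackson kernel is a trigonometric polynomial of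
    degree [2 n]. *)
Lemma rnorm_dirichlet4 n u : unit_circle u ->
  (rnorm (dirichlet n.+1 u) ^+ 4)%:C = u ^- n.*2 * dirichlet n.+1 u ^+ 4.
Proof.
move=> u1; rewrite rmorphXn/= -normE (exprM _ 2 2) normCK conj_dirichlet//.
have -> : u ^- n.*2 = (u ^- n) ^+ 2 by rewrite exprVn -exprM muln2.
ring.
Qed.

Definition dirichlet_poly n : {poly C} := \sum_(j < n) 'X^j.

Lemma horner_dirichlet n u : (dirichlet_poly n).[u] = dirichlet n u.
Proof. by rewrite horner_sum; apply: eq_bigr => j _; rewrite hornerXn. Qed.

Lemma size_dirichlet_poly n k : (size (dirichlet_poly n.+1 ^+ k) <= (n * k).+1)%N.
Proof.
have s1 : (size (dirichlet_poly n.+1) <= n.+1)%N.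
  by apply: (leq_trans (size_sum _ _ _)); apply/bigmax_leqP => j _; rewrite size_polyXn.
rewrite (leq_trans (size_poly_exp_leq _ _))// ltnS leq_mul2r.
by apply/orP; right; case: (size _) s1.
Qed.

(** The approximant averages the values of f at the nodes [w^-i] with weights [K i z / S]: a Jackson
    mean with the integral replaced by a sum over roots of unity. The weights sum to 1, and their
    second moment about [z] is of order [(n+1)^-2]. *)
Lemma jackson (a L : R) (f : C -> C) n : 0 <= a <= 2 ->
  (forall z w, unit_circle z -> unit_circle w ->
     rnorm (f z - f w) <= L * rnorm (z - w) `^ a) ->
  exists c : int -> C, forall z, unit_circle z ->
    rnorm (trig_poly n.*2 c z - f z) <= 9 * L * (n.+1%:R^-1) `^ a.
Proof.
move=> a02 hf; pose M := n.+1.*2.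
have M0 : (0 < M)%N by [].
have [w pw] := prim_root_ex (R := R) M0; have w1 := prim_root_unit_circle pw.
have w0 := unit_circle_neq0 w1.
pose K i z := rnorm (dirichlet n.+1 (z * w ^+ i)) ^+ 4.
pose r m := (dirichlet_poly n.+1 ^+ 2)`_m.
pose S := M%:R * \sum_(m < (n * 2).+1) rnorm (r m) ^+ 2.
(* The kernel is the squared modulus of a polynomial of degree [2 n < M], so by Parseval its sum
   over the nodes does not depend on [z]. *)
have sumK z : unit_circle z -> \sum_(i < M) K i z = S.
  move=> z1; rewrite /S -(parseval_scalar r pw z1); last by rewrite /M; lia.
  apply: eq_bigr => i _; rewrite /K (exprM _ 2 2); congr (_ ^+ 2).
  rewrite -rnormX -horner_dirichlet -horner_exp.
  by rewrite (horner_coef_wide _ (size_dirichlet_poly _ _)).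
have n0 : 0 < n.+1%:R :> R by rewrite ltr0n.
(* At [z = 1] the node [i = 0] alone contributes [(n+1)^4]. *)
have S_ge : n.+1%:R ^+ 4 <= S.
  rewrite -(sumK 1 unit_circle1) (bigD1 (Ordinal M0))//= /K expr0 mulr1.
  have -> : dirichlet n.+1 1 = n.+1%:R.
    rewrite /dirichlet (eq_bigr (fun=> 1)) ?sumr_const ?card_ord// => j _.
    by rewrite expr1n.
  rewrite -(rmorph_nat (real_complex R)) rnorm_real.
  by rewrite ger0_norm// lerDl sumr_ge0// => i _; rewrite exprn_ge0// rnorm_ge0.
have S0 : 0 < S by apply: lt_le_trans S_ge; rewrite exprn_gt0.
clearbody S.
(* Since [(u - 1)] times the Dirichlet kernel is [u^(n+1) - 1], of modulus at most 2, two of the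
   four kernel factors absorb the squared distance; Parseval sums the other two to
   [M (n+1) = 2 (n+1)^2]. *)
have sumK2 z : unit_circle z ->
    \sum_(i < M) rnorm (w ^- i - z) ^+ 2 * K i z <= 8 * n.+1%:R ^+ 2.
  move=> z1; have nM : (n.+1 <= M)%N by rewrite /M; lia.
  have P := parseval_scalar (fun=> 1) pw z1 nM.
  apply: (@le_trans _ _ (4 * \sum_(i < M) rnorm (dirichlet n.+1 (z * w ^+ i)) ^+ 2)).
    rewrite mulr_sumr; apply: ler_sum => i _.
    have u1 : unit_circle (z * w ^+ i) by apply: unit_circleM => //; exact: unit_circleX.
    set u := z * w ^+ i in u1 *.
    have -> : rnorm (w ^- i - z) = rnorm (u - 1).
      have -> : u - 1 = - (w ^+ i * (w ^- i - z)).
        by rewrite mulrBr divff ?expf_neq0// opprB mulrC.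
      by rewrite rnormN rnormM rnormX ((unit_circleE w).1 w1) expr1n mul1r.
    have h : rnorm (u - 1) * rnorm (dirichlet n.+1 u) <= 2.
      rewrite -rnormM -subrX1 (le_trans (ler_rnormD _ _))// rnormN rnormX.
      by rewrite ((unit_circleE u).1 u1) ((unit_circleE 1).1 unit_circle1) expr1n.
    rewrite /K -/u (_ : 4 = 2 + 2)%N// exprD mulrA -exprMn ler_wpM2r ?sqr_ge0//.
    have -> : 4 = 2 ^+ 2 :> R by rewrite -natrX.
    by rewrite ler_pXn2r// nnegrE ?mulr_ge0 ?rnorm_ge0.
  have -> : \sum_(i < M) rnorm (dirichlet n.+1 (z * w ^+ i)) ^+ 2 = M%:R * n.+1%:R.
    transitivity (M%:R * \sum_(m < n.+1) rnorm (1 : C) ^+ 2).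
      rewrite -P; apply: eq_bigr => i _; congr (rnorm _ ^+ 2).
      by apply: eq_bigr => m _; rewrite mul1r.
    by rewrite ((unit_circleE 1).1 unit_circle1) expr1n sumr_const card_ord.
  by rewrite /M -muln2 natrM le_eqVlt; apply/orP; left; apply/eqP; ring.
pose Q : {poly C} := dirichlet_poly n.+1 ^+ 4.
(* Coefficients in [z] of the weighted kernels. The shift by [2 n] makes the index nonnegative
   throughout the range used, so [absz] loses nothing there. *)
pose c (k : int) : C := \sum_(i < M) f (w ^- i) / S%:C *
  (Q`_(absz (k + n.*2%:Z)) * (w ^+ i) ^+ absz (k + n.*2%:Z) / (w ^+ i) ^+ n.*2).
exists c => z z1.
have -> : trig_poly n.*2 c z = \sum_(i < M) f (w ^- i) * (K i z / S)%:C.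
  rewrite trig_polyE//.
  under eq_bigr do rewrite /c subrK absz_nat mulr_suml.
  rewrite exchange_big/= mulr_sumr; apply: eq_bigr => i _.
  have u1 : unit_circle (z * w ^+ i) by apply: unit_circleM => //; exact: unit_circleX.
  rewrite rmorphM/= /K rnorm_dirichlet4// -horner_dirichlet -horner_exp -/Q.
  have sQ : (size Q <= n.*2.*2.+1)%N.
    by rewrite (leq_trans (size_dirichlet_poly _ _))//; lia.
  rewrite (horner_coef_wide _ sQ) fmorphV/= [X in f _ * (X * _)]mulr_sumr.
  rewrite mulr_suml !mulr_sumr.
  apply: eq_bigr => j _; rewrite !exprMn invfM; ring.
have -> : f z = \sum_(i < M) f z * (K i z / S)%:C.
  by rewrite -mulr_sumr -rmorph_sum/= -mulr_suml sumK// divff ?lt0r_neq0// mulr1.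
rewrite -sumrB (le_trans (ler_rnorm_sum _ _ _))//.
set s := n.+1%:R^-1; have s0 : 0 < s by rewrite invr_gt0.
have K0 i : 0 <= K i z by rewrite exprn_ge0 ?rnorm_ge0.
have L0 : 0 <= L.
  have := le_trans (rnorm_ge0 _) (hf _ _ unit_circle1 (unit_circleN unit_circle1)).
  rewrite pmulr_lge0// powR_gt0// lt_def rnorm_ge0 rnorm_eq0 opprK andbT.
  by rewrite -mulr2n pnatr_eq0.
(* With the scale [s = 1/(n+1)], the first term sums to S and the second to at most
   [8 (n+1)^4 <= 8 S]: hence the constant 9. *)
apply: (@le_trans _ _ (\sum_(i < M) L * s `^ a / S *
    (K i z + n.+1%:R ^+ 2 * (rnorm (w ^- i - z) ^+ 2 * K i z)))).
  apply: ler_sum => i _; rewrite -mulrBl rnormM rnorm_real ger0_norm; last first.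
    by rewrite divr_ge0// ltW.
  have wi : unit_circle (w ^- i) by exact/unit_circleV/unit_circleX.
  have KS : 0 <= K i z / S by rewrite divr_ge0// ltW.
  apply: (le_trans (ler_wpM2r KS (hf _ _ wi z1))).
  have := powR_le_quadratic a02 s0 (rnorm_ge0 (w ^- i - z)).
  move=> /(ler_wpM2l L0)/(ler_wpM2r KS)/le_trans; apply.
  by rewrite /s invrK le_eqVlt; apply/orP; left; apply/eqP; ring.
rewrite -mulr_sumr big_split/= sumK// -mulr_sumr.
have := sumK2 _ z1; set T := \sum_(i < M) _ => hT.
have -> : 9 * L * s `^ a = L * s `^ a / S * (9 * S) by field; rewrite lt0r_neq0.
rewrite ler_wpM2l//; first by rewrite divr_ge0 ?mulr_ge0 ?powR_ge0// ltW.
have : n.+1%:R ^+ 2 * T <= n.+1%:R ^+ 2 * (8 * n.+1%:R ^+ 2).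
  by rewrite ler_wpM2l// sqr_ge0.
have -> : n.+1%:R ^+ 2 * (8 * n.+1%:R ^+ 2) = 8 * n.+1%:R ^+ 4 :> R by ring.
by move: S_ge; lra.
Qed.

End jackson.

(** * Operator norm, boundedness and completeness *)

Section operator_norm.
Context {R : realType} {H : hilbertType R}.
Local Notation C := R[i].
Implicit Types (A : H -> H) (x y : H).

Lemma complex_gt0P (e : C) : 0 < e -> exists2 r : R, 0 < r & e = r%:C.
Proof.
move=> e0; have re : e \is Num.real by rewrite gtr0_real.
by exists (complex.Re e); rewrite ?RRe_real// -ltcR RRe_real.
Qed.

Lemma opnorm_le A (K : R) :
  (forall x, rnorm x <= 1 -> rnorm (A x) <= K) -> opnorm A <= K.
Proof.
move=> hA; apply: ge_sup; last by move=> _ [x /= x1 <-]; exact: hA.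
by exists (rnorm (A 0)); exists 0 => //=; rewrite rnorm0 ler01.
Qed.

(** True of any map, since the supremum takes the value 0 when it does not exist. *)
Lemma opnorm_ge0 A : 0 <= opnorm A.
Proof.
rewrite /opnorm; set E := [set _ | _ in _].
have E0 : E (rnorm (A 0)) by exists 0 => //=; rewrite rnorm0 ler01.
have [hE|hE] := pselect (has_sup E).
  by apply: le_trans (sup_upper_bound hE E0); exact: rnorm_ge0.
by rewrite sup_out.
Qed.

(** Scale [x] to norm 1; the bound [K] ensures that the supremum is a genuine one. *)
Lemma rnorm_le_opnorm A (K : R) x : (forall a y, A (a *: y) = a *: A y) ->
  (forall y, rnorm (A y) <= K * rnorm y) -> rnorm (A x) <= opnorm A * rnorm x.
Proof.
move=> lA hA; have [->|x0] := eqVneq x 0.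
  have -> : A 0 = 0 by rewrite -(scale0r (0 : H)) lA !scale0r.
  by rewrite rnorm0 mulr0.
have nx : 0 < rnorm x by rewrite lt_def rnorm_ge0 rnorm_eq0 x0.
have K0 : 0 <= K.
  by rewrite -(pmulr_lge0 K nx); apply: le_trans (rnorm_ge0 _) (hA x).
have -> : rnorm (A x) = rnorm (A ((rnorm x)^-1%:C *: x)) * rnorm x.
  rewrite lA rnormZ rnorm_real ger0_norm ?invr_ge0 ?(ltW nx)//.
  by rewrite mulrAC mulVf ?gt_eqF// mul1r.
rewrite ler_wpM2r ?(ltW nx)//; apply: ub_le_sup.
  exists K => _ [y /= y1 <-]; apply: le_trans (hA y) _.
  by rewrite -[leRHS]mulr1 ler_wpM2l.
exists ((rnorm x)^-1%:C *: x) => //=.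
by rewrite rnormZ rnorm_real ger0_norm ?invr_ge0 ?(ltW nx)// mulVf ?gt_eqF.
Qed.

Lemma bounded_operatorP A : bounded_operator A <->
  linear A /\ exists K : R, forall x, rnorm (A x) <= K * rnorm x.
Proof.
split=> -[lA].
  pose f : {linear H -> H} := HB.pack A (GRing.isLinear.Build _ _ _ _ A lA).
  move=> /(linear_bounded_continuous f)/linear_boundedP/filter_ex[r hr].
  split=> //; exists (complex.Re r) => x; have := hr x.
  by rewrite !normE lecE => /andP[_]; case: (r) => r1 r2 /=; rewrite mulr0 subr0.
move=> [K hK]; split=> //.
pose f : {linear H -> H} := HB.pack A (GRing.isLinear.Build _ _ _ _ A lA).
apply/(linear_bounded_continuous f)/linear_boundedP.
exists K%:C; split=> [|r Kr x].
  by rewrite complex_real.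
rewrite (le_trans (_ : _ <= K%:C * `|x|))//.
  by rewrite !normE -rmorphM lecR hK.
by rewrite ler_wpM2r// ltW.
Qed.

Lemma linear_operatorZ A a x : linear A -> A (a *: x) = a *: A x.
Proof.
move=> lA; have A0 : A 0 = 0.
  have := lA 1 0 0; rewrite !scale1r addr0.
  by move=> /(congr1 (fun z => z - A 0)); rewrite subrr addrK.
by have := lA a x 0; rewrite !addr0 A0 addr0.
Qed.

Lemma rnorm_cauchy_cvg (u : nat -> H) :
  (forall e : R, 0 < e -> exists N, forall k, (N <= k)%N -> rnorm (u N - u k) < e) ->
  exists l, forall e : R, 0 < e -> exists N, forall k, (N <= k)%N -> rnorm (u k - l) <= e.
Proof.
move=> hu; have /cauchy_cvgP cu : cauchy (u @ \oo).
  apply: cauchy_exP => _ /complex_gt0P[e e0 ->].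
  have [N hN] := hu e e0; exists (u N); exists N => // k /= Nk.
  by rewrite -ball_normE/= normE ltcR hN.
exists (lim (u @ \oo)) => e e0.
have /cvgrPdist_le/(_ e%:C) := cu.
rewrite ltcR => /(_ e0)[N _ hN]; exists N => k Nk.
by have := hN k Nk; rewrite /= normE lecR rdistrC.
Qed.

End operator_norm.

(** * Existence and approximation of f(U) *)

Section functional_calculus.
Context {R : realType}.
Local Notation C := R[i].

(** Coefficients of index beyond the degree are arbitrary, so they are cut off before a polynomial
    is rewritten with a larger degree. *)
Definition truncate n (c : int -> C) (k : int) : C :=
  if (absz k <= n)%N then c k else 0.

Lemma laurent_widen (V : lmodType C) (E : int -> V) n N (c : int -> C) : (n <= N)%N ->
  \sum_(j < N.*2.+1) truncate n c (j%:Z - N%:Z) *: E (j%:Z - N%:Z) =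
  \sum_(j < n.*2.+1) c (j%:Z - n%:Z) *: E (j%:Z - n%:Z).
Proof.
move=> nN.
rewrite -(big_mkord xpredT
  (fun j : nat => truncate n c (j%:Z - N%:Z) *: E (j%:Z - N%:Z))).
rewrite (big_cat_nat (n := (N - n)%N))//=; last by lia.
rewrite (big_cat_nat (n := (n.*2.+1 + (N - n))%N) (m := (N - n)%N))//=; [|lia|lia].
rewrite big_nat_cond [X in X + _]big1 ?add0r => [|j hj]; last first.
  rewrite /truncate ifF ?scale0r//; apply/negbTE; lia.
rewrite [X in _ + X]big_nat_cond [X in _ + X]big1 ?addr0 => [|j hj]; last first.
  rewrite /truncate ifF ?scale0r//; apply/negbTE; lia.
rewrite -{1}[(N - n)%N]add0n big_addn addnK big_mkord; apply: eq_bigr => j _.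
have -> : (j + (N - n))%:Z - N%:Z = j%:Z - n%:Z by lia.
by rewrite /truncate ifT//; have := ltn_ord j; lia.
Qed.

(** A single family [e] serves the circle and every unitary operator, so that bounds on the circle
    transfer to differences of operators. *)
Lemma trig_poly_sub n (c : int -> C) m (d : int -> C) : exists e : int -> C,
  (forall z, trig_poly (maxn n m) e z = trig_poly n c z - trig_poly m d z) /\
  forall (H : hilbertType R) (U : unitary H) x,
    trig_poly_op (maxn n m) e U x = trig_poly_op n c U x - trig_poly_op m d U x.
Proof.
exists (fun k => truncate n c k - truncate m d k); split=> [z|H U x].
  have := laurent_widen (V := C^o) (exprz z) c (leq_maxl n m).
  have := laurent_widen (V := C^o) (exprz z) d (leq_maxr n m).
  rewrite /trig_poly => <- <-; rewrite -sumrB; apply: eq_bigr => j _.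
  by rewrite mulrBl.
rewrite /trig_poly_op -(laurent_widen (fun k => unitary_pow U k x) c (leq_maxl n m)).
rewrite -(laurent_widen (fun k => unitary_pow U k x) d (leq_maxr n m)) -sumrB.
by apply: eq_bigr => j _; rewrite scalerBl.
Qed.

Lemma trig_poly_sup_sub (f : C -> C) n (c : int -> C) m (d : int -> C) (r s : R) e z :
  (forall z, unit_circle z -> rnorm (trig_poly n c z - f z) <= r) ->
  (forall z, unit_circle z -> rnorm (trig_poly m d z - f z) <= s) ->
  (forall z, trig_poly (maxn n m) e z = trig_poly n c z - trig_poly m d z) ->
  unit_circle z -> rnorm (trig_poly (maxn n m) e z) <= r + s.
Proof.
move=> hr hs -> z1; apply: (le_trans (ler_rdistD (f z) _ _)).
by rewrite lerD ?hr// rdistrC hs.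
Qed.

Context {H : hilbertType R}.
Implicit Types (U V : unitary H).

Lemma trig_poly_op_dist U (f : C -> C) n (c : int -> C) m (d : int -> C) (r s : R) x :
  (forall z, unit_circle z -> rnorm (trig_poly n c z - f z) <= r) ->
  (forall z, unit_circle z -> rnorm (trig_poly m d z - f z) <= s) ->
  rnorm (trig_poly_op n c U x - trig_poly_op m d U x) <= (r + s) * rnorm x.
Proof.
move=> hr hs; have [e [ez eU]] := trig_poly_sub n c m d.
rewrite -eU; apply: rnorm_trig_poly_op_le => z z1.
exact: trig_poly_sup_sub hr hs ez z1.
Qed.

Lemma trig_poly_op_linear n (c : int -> C) U : linear (trig_poly_op n c U).
Proof.
have lin k (W : {linear H -> H}) a x y :
    iter k W (a *: x + y) = a *: iter k W x + iter k W y.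
  by elim: k => //= k ->; rewrite linearP.
move=> a x y; rewrite /trig_poly_op scaler_sumr -big_split/=.
apply: eq_bigr => j _; rewrite scalerA [a * _]mulrC -scalerA -scalerDr.
by congr (_ *: _); case: (_ - _) => k; exact: lin.
Qed.

Lemma trig_poly_op_bounded n (c : int -> C) U :
  exists K : R, forall x, rnorm (trig_poly_op n c U x) <= K * rnorm x.
Proof.
exists (\sum_(j < n.*2.+1) rnorm (c (j%:Z - n%:Z))) => x.
rewrite (le_trans (ler_rnorm_sum _ _ _))// mulr_suml; apply: ler_sum => j _.
rewrite rnormZ ler_wpM2l ?rnorm_ge0// unitary_powB.
by rewrite !iter_isometry//; [exact: unitary_isometry|exact: adjoint_isometry].
Qed.

(** Applies to any polynomial close to f, not only to the sequence witnessing [is_fcalc]: von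
    Neumann's inequality compares it with a late member of that sequence. *)
Lemma is_fcalc_dist U (f : C -> C) A n (c : int -> C) (r : R) x :
  is_fcalc f U A ->
  (forall z, unit_circle z -> rnorm (trig_poly n c z - f z) <= r) ->
  rnorm (trig_poly_op n c U x - A x) <= r * rnorm x.
Proof.
move=> [/bounded_operatorP[lA [K hK]] [m [d [unif cv]]]] hr.
apply/ler_addgt0Pr => e e0.
(* Two errors of size [e' * rnorm x] must fit into [e]; the added 1 avoids dividing by zero. *)
pose e' := e / (2 * (rnorm x + 1)).
have x1 : 0 < rnorm x + 1 by rewrite ltr_wpDl ?rnorm_ge0.
have e'0 : 0 < e' by rewrite divr_gt0// mulr_gt0.
have e'x : 2 * e' * rnorm x <= e.
  have -> : 2 * e' * rnorm x = e * (rnorm x / (rnorm x + 1)).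
    by rewrite /e'; field; rewrite gt_eqF.
  rewrite -[leRHS]mulr1 ler_wpM2l ?(ltW e0)// ler_pdivrMr// mul1r.
  by rewrite lerDl.
have /cvgrPdist_le/(_ e' e'0) near1 := cv.
have [k [h1 h2]] := filter_ex (filterI near1 (unif e' e'0)).
have {}h1 : opnorm (trig_poly_op (m k) (d k) U \- A) <= e'.
  by move: h1; rewrite /= sub0r normrN ger0_norm ?opnorm_ge0.
have [B hB] := trig_poly_op_bounded (m k) (d k) U.
have h3 : rnorm (trig_poly_op (m k) (d k) U x - A x) <= e' * rnorm x.
  apply: (@le_trans _ _ (opnorm (trig_poly_op (m k) (d k) U \- A) * rnorm x)).
    apply: (@rnorm_le_opnorm _ _ (trig_poly_op (m k) (d k) U \- A) (B + K)) => [a y|y] /=.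
      rewrite (linear_operatorZ a y lA) scalerBr.
      by rewrite (linear_operatorZ a y (trig_poly_op_linear (m k) (d k) U)).
    by rewrite mulrDl (le_trans (ler_rnormD _ _))// rnormN lerD.
  by rewrite ler_wpM2r ?rnorm_ge0.
apply: (le_trans (ler_rdistD (trig_poly_op (m k) (d k) U x) _ _)).
have := trig_poly_op_dist U x hr h2; lra.
Qed.

(** Von Neumann's inequality makes the polynomial operators Cauchy at each vector. The rate [r k]
    survives in the pointwise limit ([TA]), which yields linearity, boundedness and convergence in
    operator norm. *)
Lemma is_fcalc_ex U (f : C -> C) (n : nat -> nat) (c : nat -> int -> C) (r : nat -> R) :
  r k @[k --> \oo] --> (0 : R) ->
  (forall k z, unit_circle z -> rnorm (trig_poly (n k) (c k) z - f z) <= r k) ->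
  exists A, is_fcalc f U A.
Proof.
move=> r0 hr; pose T k x := trig_poly_op (n k) (c k) U x.
have r_small (e : R) : 0 < e -> exists N, forall k, (N <= k)%N -> r k <= e.
  move=> e0; have /cvgrPdist_le/(_ e e0)[N _ hN] := r0.
  exists N => k /hN /=; rewrite sub0r normrN; exact: le_trans (ler_norm _).
have TT k l x : rnorm (T k x - T l x) <= (r k + r l) * rnorm x.
  exact: trig_poly_op_dist (hr k) (hr l).
have r_ge0 k : 0 <= r k.
  by apply: le_trans (rnorm_ge0 _) (hr k _ unit_circle1).
have small (x : H) (e : R) : 0 < e ->
    exists N, forall k, (N <= k)%N -> r k * rnorm x <= e.
  move=> e0; have x1 : 0 < rnorm x + 1 by rewrite ltr_wpDl ?rnorm_ge0.
  have [N hN] := r_small _ (divr_gt0 e0 x1); exists N => k Nk.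
  apply: (@le_trans _ _ (r k * (rnorm x + 1))).
    by rewrite ler_wpM2l// lerDl.
  by rewrite -ler_pdivlMr// hN.
have lim_ex x : exists l, forall e : R, 0 < e ->
    exists N, forall k, (N <= k)%N -> rnorm (T k x - l) <= e.
  apply: rnorm_cauchy_cvg => e e0.
  have e3 : 0 < e / 3 by rewrite divr_gt0.
  have [N hN] := small x _ e3; exists N => k Nk.
  apply: le_lt_trans (TT N k x) _.
  by have := hN _ (leqnn N); have := hN _ Nk; lra.
have [A hA] := choice lim_ex.
have TA k x : rnorm (T k x - A x) <= r k * rnorm x.
  apply/ler_addgt0Pr => e e0; have e2 : 0 < e / 2 by rewrite divr_gt0.
  have [N1 h1] := small x _ e2; have [N2 h2] := hA x _ e2.
  apply: (le_trans (ler_rdistD (T (maxn N1 N2) x) _ _)).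
  have := TT k (maxn N1 N2) x.
  by have := h1 _ (leq_maxl N1 N2); have := h2 _ (leq_maxr N1 N2); lra.
have lA : linear A.
  move=> a x y; apply/eqP; rewrite -subr_eq0 -rnorm_eq0 eq_le rnorm_ge0 andbT.
  (* The defect of linearity of [A] is the sum of three approximation errors, at most [r N * K] in
     total, because the polynomial operator is linear. *)
  pose K := rnorm (a *: x + y) + rnorm a * rnorm x + rnorm y.
  apply/ler_addgt0Pr => e e0; rewrite add0r.
  have K1 : 0 < K + 1.
    by rewrite ltr_wpDl// !addr_ge0 ?mulr_ge0 ?rnorm_ge0.
  have [N hN] := r_small _ (divr_gt0 e0 K1).
  have {hN} := hN N (leqnn N); rewrite ler_pdivlMr// => hN.
  have -> : A (a *: x + y) - (a *: A x + A y) =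
      - (T N (a *: x + y) - A (a *: x + y)) +
      (a *: (T N x - A x) + (T N y - A y)).
    by rewrite /T trig_poly_op_linear scalerBr [in RHS]addrACA -opprD opprB subrKA.
  apply: (le_trans (ler_rnormD _ _)); rewrite rnormN.
  have := ler_rnormD (a *: (T N x - A x)) (T N y - A y); rewrite rnormZ.
  have := ler_wpM2l (rnorm_ge0 a) (TA N x).
  have := TA N y; have := TA N (a *: x + y).
  have := r_ge0 N; move: hN; rewrite /K; lra.
exists A; split.
  apply/bounded_operatorP; split=> //.
  have [K hK] := trig_poly_op_bounded (n 0%N) (c 0%N) U.
  exists (K + r 0%N) => x; rewrite -[A x](subKr (T 0%N x)).
  rewrite (le_trans (ler_rnormD _ _))// rnormN mulrDl lerD//.
  exact: hK.
exists n, c; split.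
  move=> e e0; have [N hN] := r_small _ e0; exists N => // k /= Nk z z1.
  exact: le_trans (hr _ _ z1) (hN _ Nk).
apply: (squeeze_cvgr (f := fun=> 0) (h := r)) => //; last exact: cvg_cst.
apply: nearW => k; rewrite opnorm_ge0/=; apply: opnorm_le => x x1.
by apply: le_trans (TA k x) _; rewrite -[leRHS]mulr1 ler_wpM2l.
Qed.

End functional_calculus.

(** * Hölder seminorm and dyadic blocks *)

Section operator_hoelder.
Context {R : realType}.
Local Notation C := R[i].

Lemma holder_seminormP (a : R) (f : C -> C) z w : 0 < a -> holder a f ->
  unit_circle z -> unit_circle w ->
  rnorm (f z - f w) <= holder_seminorm a f * rnorm (z - w) `^ a.
Proof.
move=> a0 [K hK] z1 w1; have [->|zw] := eqVneq z w.
  by rewrite !subrr !rnorm0 powR0 ?gt_eqF// mulr0.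
have d0 u v : u != v -> 0 < rnorm (u - v :> C) `^ a.
  by move=> uv; rewrite powR_gt0// lt_def rnorm_ge0 rnorm_eq0 subr_eq0 uv.
rewrite -ler_pdivrMr ?d0//; apply: ub_le_sup; last by exists z, w.
by exists K => _ [u [v [u1 v1 uv ->]]]; rewrite ler_pdivrMr ?d0// hK.
Qed.

Lemma holder_seminorm_ge0 (a : R) (f : C -> C) : 0 < a -> holder a f ->
  0 <= holder_seminorm a f.
Proof.
move=> a0 hf; have N1 := unit_circleN (unit_circle1 (R := R)).
have := le_trans (rnorm_ge0 _) (holder_seminormP a0 hf unit_circle1 N1).
rewrite pmulr_lge0// powR_gt0// lt_def rnorm_ge0 rnorm_eq0 opprK andbT.
by rewrite -mulr2n pnatr_eq0.
Qed.

Lemma powR_exprn (x a : R) n : 0 <= x -> (x ^+ n) `^ a = (x `^ a) ^+ n.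
Proof. by move=> x0; rewrite -!powR_mulrn ?powR_ge0// powRAC. Qed.

(** Take the least m with [d * 2^m > 1]: minimality bounds it by 2 if [m > 0], and the hypothesis
    [d <= 2] does if [m = 0]. *)
Lemma dyadic_scale (d : R) : 0 < d <= 2 -> exists m, 1 < d * 2 ^+ m <= 2.
Proof.
move=> /andP[d0 d2].
have ex : exists m, 1 < d * 2 ^+ m.
  exists (Num.bound d^-1); rewrite mulrC -ltr_pdivrMr// mul1r.
  apply: (lt_trans (archi_boundP _)); first by rewrite invr_ge0 ltW.
  by rewrite -natrX ltr_nat ltn_expl.
case: (ex_minnP ex) => m hm min; exists m; rewrite hm/=.
case: m hm min => [|m] _ min; first by rewrite expr0 mulr1.
have : ~~ (1 < d * 2 ^+ m) by apply/negP => /min; rewrite ltnn.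
by rewrite -leNgt exprS mulrCA => h; rewrite -[leRHS]mulr1 ler_wpM2l.
Qed.

Context {H : hilbertType R}.
Implicit Types (U V : unitary H).

Lemma unitary_sub_opnorm U V :
  opnorm (U \- V) <= 2 /\ forall x, rnorm (U x - V x) <= opnorm (U \- V) * rnorm x.
Proof.
have le2 x : rnorm ((U \- V) x) <= 2 * rnorm x.
  by rewrite /= (le_trans (ler_rnormD _ _))// rnormN !unitary_isometry; lra.
split=> [|x].
  by apply: opnorm_le => x x1; have := le2 x; lra.
apply: (rnorm_le_opnorm (A := U \- V) _ _ le2) => b y.
by rewrite /= scalerBr !linearZ_LR.
Qed.

(* Dyadic decomposition: the blocks p_(m+1) - p_m have degree O(2^m) and
   supremum O(2^-(a m)), so that Bernstein's inequality bounds their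
   contributions by a geometric sum of ratio 2^(1-a) > 1. *)
Lemma dyadic_lipschitz (f : C -> C) (c : nat -> int -> C) (K q d : R) U V m x :
  2^-1 < q <= 1 -> 0 <= K ->
  (forall m z, unit_circle z ->
     rnorm (trig_poly (2 ^ m).-1.*2 (c m) z - f z) <= K * q ^+ m) ->
  (forall y, rnorm (U y - V y) <= d * rnorm y) -> 0 <= d ->
  rnorm (trig_poly_op (2 ^ m).-1.*2 (c m) U x - trig_poly_op (2 ^ m).-1.*2 (c m) V x)
    <= 24 / (2 * q - 1) * K * d * (2 * q) ^+ m * rnorm x.
Proof.
move=> /andP[q2 q1] K0 hc hd d0; have q0 : 0 <= q by lra.
have k0 : 0 < 2 * q - 1 by lra.
elim: m => [|m IH].
  (* At [m = 0] the degree is 0, so the polynomial is a constant and the difference vanishes. *)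
  rewrite /trig_poly_op !big_ord1 /= subrr rnorm0 !mulr_ge0 ?rnorm_ge0 ?exprn_ge0//.
    by rewrite invr_ge0 ltW.
  by lra.
pose T k W := trig_poly_op (2 ^ k).-1.*2 (c k) W x.
rewrite -/(T m.+1 U) -/(T m.+1 V); rewrite -/(T m U) -/(T m V) in IH.
have [e [ez eU]] := trig_poly_sub (2 ^ m.+1).-1.*2 (c m.+1) (2 ^ m).-1.*2 (c m).
have sup_e z (z1 : unit_circle z) := trig_poly_sup_sub (hc m.+1) (hc m) ez z1.
have := trig_poly_op_lipschitz x sup_e hd; rewrite !eU.
rewrite -/(T m.+1 U) -/(T m U) -/(T m.+1 V) -/(T m V).
set deg := maxn _ _ => blk.
have hdeg : (3 * deg + 1)%:R <= 12 * 2 ^+ m :> R.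
  rewrite -natrX -natrM ler_nat /deg.
  have : (0 < 2 ^ m)%N by rewrite expn_gt0.
  by rewrite expnS; move: (2 ^ m)%N => t; lia.
have -> : T m.+1 U - T m.+1 V = (T m U - T m V) +
    ((T m.+1 U - T m U) - (T m.+1 V - T m V)).
  by rewrite [- (_ - T m V)]opprB [RHS]addrCA !subrKA.
apply: (le_trans (ler_rnormD _ _)).
apply: (le_trans (lerD IH blk)).
rewrite -mulrDl ler_wpM2r ?rnorm_ge0//.
have {hdeg} : (3 * deg + 1)%:R * (K * q ^+ m.+1 + K * q ^+ m) * d <=
    12 * 2 ^+ m * (K * q ^+ m * 2) * d.
  rewrite ler_wpM2r// ler_pM// ?addr_ge0 ?mulr_ge0 ?exprn_ge0//.
  have : 0 <= K * q ^+ m by rewrite mulr_ge0 ?exprn_ge0.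
  by rewrite exprS mulrCA; set t := K * _ => t0; nra.
move=> h; apply: (le_trans (lerD (lexx _) h)).
have -> : 12 * 2 ^+ m * (K * q ^+ m * 2) * d = 24 * K * d * (2 * q) ^+ m.
  by rewrite exprMn; ring.
(* The constant [A = 24 / (2 q - 1)] solves [A + 24 = 2 q A], which closes the induction. *)
rewrite exprS le_eqVlt; apply/orP; left; apply/eqP; field.
by rewrite gt_eqF.
Qed.

End operator_hoelder.

(** * Balancing approximation against the Lipschitz bound *)

Unset Implicit Arguments.

Theorem theorem5p1 (R : realType) (a : R) (a_gt0 : 0 < a) (a_lt1 : a < 1) :
  exists c : R, 0 < c /\
    forall (f : R[i] -> R[i]), holder a f ->
    forall (H : hilbertType R) (U V : unitary H),
      opnorm (fcalc f U \- fcalc f V)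
        <= c * holder_seminorm a f * opnorm (U \- V) `^ a.
Proof.
pose q : R := 2^-1 `^ a.
(* This is where [a < 1] enters: [2 q = 2^(1-a)] exceeds 1. *)
have q2 : 2^-1 < q.
  have qV : q * 2 `^ a = 1 by rewrite /q -powRM ?invr_ge0// mulVf// powR1.
  have p0 : 0 < 2 `^ a :> R by rewrite powR_gt0.
  have : (1 : R) < 2 `^ (1 - a).
    have b0 : 0 < 1 - a by lra.
    have := @gt0_ltr_powR R _ b0 1 2; rewrite powR1; apply; rewrite ?nnegrE//.
    by rewrite ltr1n.
  rewrite powRB ?pnatr_eq0 ?implybT// powRr1// ltr_pdivlMr// mul1r => h.
  rewrite -(ltr_pM2r p0) qV; lra.
have q1 : q < 1.
  have := @gt0_ltr_powR R _ a_gt0 2^-1 1.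
  rewrite powR1; apply; rewrite ?nnegrE ?invr_ge0//.
  by rewrite invf_lt1// ltr1n.
have k0 : 0 < 2 * q - 1 by lra.
pose c1 : R := 9 * (24 / (2 * q - 1)).
have c10 : 0 < c1 by rewrite mulr_gt0// divr_gt0.
(* 18 comes from the Jackson errors for [U] and for [V], 9 each; [c1] is the dyadic constant times
   9, and its factor 2 is the bound on [d * 2^m] at the chosen scale. *)
exists (18 + 2 * c1); split; first by rewrite addr_gt0// mulr_gt0.
move=> f hf H U V; set L := holder_seminorm a f.
have L0 : 0 <= L by exact: holder_seminorm_ge0.
have a02 : 0 <= a <= 2 by rewrite (ltW a_gt0)/=; lra.
have approx m : exists c : int -> R[i], forall z, unit_circle z ->
    rnorm (trig_poly (2 ^ m).-1.*2 c z - f z) <= 9 * L * q ^+ m.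
  have [e he] := jackson (2 ^ m).-1 a02
    (fun z w => @holder_seminormP _ a f z w a_gt0 hf).
  exists e => z z1; have := he z z1.
  by rewrite prednK ?expn_gt0// natrX -exprVn powR_exprn// invr_ge0.
have [c hc] := choice approx.
have r0 : 9 * L * q ^+ k @[k --> \oo] --> (0 : R).
  by apply: cvg_geometric; rewrite ger0_norm ?powR_ge0.
(* The Jackson means show that f(U) exists, so [fcalc] is never its default value here. *)
have fcalcP (W : unitary H) : is_fcalc f W (fcalc f W).
  rewrite /fcalc; apply: (@xgetPex _ _ (is_fcalc f W)).
  exact: is_fcalc_ex r0 hc.
have [d2 hd] := unitary_sub_opnorm U V; set d := opnorm _ in d2 hd *.
have d0 : 0 <= d := opnorm_ge0 _.
have K0 : 0 <= 9 * L by rewrite mulr_ge0.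
have q12 : 2^-1 < q <= 1 by rewrite q2 ltW.
have main m x : rnorm (fcalc f U x - fcalc f V x) <=
    (18 * L * q ^+ m + c1 * L * (d * 2 ^+ m) * q ^+ m) * rnorm x.
  have := dyadic_lipschitz m x q12 K0 hc hd d0.
  have := is_fcalc_dist x (fcalcP U) (hc m).
  have := is_fcalc_dist x (fcalcP V) (hc m).
  set TU := trig_poly_op _ _ U x; set TV := trig_poly_op _ _ V x => hV hU hT.
  have -> : (18 * L * q ^+ m + c1 * L * (d * 2 ^+ m) * q ^+ m) * rnorm x =
    9 * L * q ^+ m * rnorm x + (24 / (2 * q - 1) * (9 * L) * d * (2 * q) ^+ m * rnorm x +
    9 * L * q ^+ m * rnorm x) by rewrite /c1 exprMn; ring.
  apply: (le_trans (ler_rdistD TU _ _)); rewrite lerD//; first by rewrite rdistrC.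
  by apply: (le_trans (ler_rdistD TV _ _)); rewrite lerD.
clearbody c1; apply: opnorm_le => x x1 /=.
(* For [d = 0] there is no scale with [d * 2^m > 1]; instead m tends to infinity and only the
   vanishing approximation error remains. *)
move: d0; rewrite le_eqVlt => /predU1P[d0|d0].
  rewrite -d0 powR0 ?gt_eqF// mulr0; apply/ler_addgt0Pr => e e0; rewrite add0r.
  have e2 : 0 < e / 2 by rewrite divr_gt0.
  have /cvgrPdist_le/(_ _ e2)/filter_ex[m] := r0.
  rewrite sub0r normrN => /(le_trans (ler_norm _)) hm.
  have := main m x; rewrite -d0 !(mul0r, mulr0, addr0) => /le_trans; apply.
  have : 0 <= 9 * L * q ^+ m by rewrite mulr_ge0// exprn_ge0// powR_ge0.
  have := rnorm_ge0 x; nra.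
have [m /andP[m1 m2]] := dyadic_scale (introT andP (conj d0 d2)).
have p0 : 0 < 2 ^+ m :> R by rewrite exprn_gt0.
(* From [2^-m < d], since [q^m = (2^-m)^a]. *)
have qm : q ^+ m <= d `^ a.
  rewrite -powR_exprn ?invr_ge0// exprVn.
  apply: ge0_ler_powR; rewrite ?nnegrE ?(ltW a_gt0) ?invr_ge0 ?(ltW d0) ?(ltW p0)//.
  by rewrite -[_^-1]mul1r ler_pdivrMr// ltW.
have q0 : 0 <= q ^+ m by rewrite exprn_ge0// powR_ge0.
apply: (le_trans (main m x)).
apply: (@le_trans _ _ (18 * L * q ^+ m + c1 * L * (d * 2 ^+ m) * q ^+ m)).
  rewrite -[leRHS]mulr1 ler_wpM2l// addr_ge0 ?mulr_ge0 ?(ltW c10) ?(ltW d0) ?(ltW p0)//.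
apply: (@le_trans _ _ ((18 + 2 * c1) * L * q ^+ m)).
  have : c1 * L * q ^+ m * (d * 2 ^+ m) <= c1 * L * q ^+ m * 2.
    by rewrite ler_wpM2l// !mulr_ge0// (ltW c10).
  lra.
by rewrite ler_wpM2l// mulr_ge0// addr_ge0// mulr_ge0// (ltW c10).
Qed.
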